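(* In type $(B_n,n)$, the set consisting of (a) all rectangular moves $(x,y,S_0)$, where $x<y$ are boxes of an order ideal $O\subseteq Q$ such that $[x,y]$ is a rectangle (the box in the row of $x$ and column of $y$ belongs to $Q$) with at least two rows and two columns, and $S_0$ fills $(x,y)$ with $+$ at the box in the row of $y$ and column of $x$ and at the box in the row of $x$ and column of $y$ and $0$ elsewhere; and (b) all diagonal moves $(x,y,S_1)$, where $x<y$ are distinct diagonal boxes of $O$ and $S_1$ fills $(x,y)$ with $+$ at the box in the row of $y$ and column of $x$ and $0$ elsewhere, is a complete set of $\Gamma$-moves.
   Context: $W$: Weyl group of type $B_n$, simple reflections $s_1,\dots,s_n$ ($s_is_{i+1}$ of order 3 for $i\le n-2$, $s_{n-1}s_n$ of order 4, others commute), Bruhat order $<$. $Q$: boxes $(r,c)$, $1\le r\le n$ (rows top to bottom), $1\le c\le n-r+1$, labeled $s_{r+c-1}$; diagonal boxes have $c=n-r+1$; order = transitive closure of $(r,c)\lessdot(r,c+1)$, $(r,c)\lessdot(r-1,c)$; order ideals are down-closed. For convex $C$ and $D:C\to\{0,+\}$ (an $\oplus$-diagram), with linear extension $b_1,\dots,b_m$ of $C$, put $t_k=s_{b_k}$ if $D(b_k)=0$, $t_k=1$ if $D(b_k)=+$, $v(D)=t_m\cdots t_1$. For an order ideal $O$, $D$ is a $\Gamma$-diagram if with $s_{i_k}=s_{b_{m+1-k}}$, $v_{(0)}=1$, $v_{(k)}=t_m\cdots t_{m+1-k}$ one has $v_{(k-1)}<v_{(k-1)}s_{i_k}$ for all $k$.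 Each $\oplus$-diagram $D$ of shape $O$ has a unique $\Gamma$-diagram $D_+$ of shape $O$ with $v(D_+)=v(D)$. $D$ of shape $(x,y)=\{z:x<z<y\}$ is compatible with $S:(x,y)\to\{0,+,?\}$ if $D(z)=S(z)$ whenever $S(z)\neq?$. A $\Gamma$-move is a triple $(x,y,S)$, $x<y$, with $v(D\cup x)=v(D\cup y)$ for all $D$ compatible with $S$ ($D\cup x$, $D\cup y$ extend $D$ by $0$ at $x$, resp. $y$). A move can be performed on $D$ of shape $O\supseteq[x,y]$ if $D(y)=0$ and $D|_{(x,y)}$ is compatible with $S$; the result sets $D(y)=+$ and switches the symbol at $x$. A set $M$ of $\Gamma$-moves is complete if every $\oplus$-diagram $D$ can be transformed into $D_+$ by finitely many moves from $M$. *)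

(* Defs.v *)
From Stdlib Require Export Relations.
From HB Require Import structures.
From mathcomp Require Export all_boot all_fingroup.
From mathcomp Require Import zify.

Set Implicit Arguments.
Unset Strict Implicit.
Unset Printing Implicit Defensive.

Local Open Scope group_scope.

(* The Weyl group of type B_n is realized as the group of signed permutations,
   acting on the 2n points ±e_0, ..., ±e_(n-1); the pair (i, b) stands for e_i
   if b = false and for -e_i if b = true.  The simple reflections are indexed
   from 0: simple i is s_(i+1).  For i < n - 1 it exchanges e_i and e_(i+1),
   and simple (n-1) exchanges e_(n-1) and -e_(n-1).  (When i.+1 < n, the cyclic
   successor ordS i is i + 1.)  The Coxeter relations are simple_sq,
   simple_commute, simple_braid3 and simple_braid4 below. *)
Definition signed_perm (n : nat) := {perm 'I_n * bool}.

Definition simple (n : nat) (i : 'I_n) : signed_perm n :=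
  if i.+1 < n
  then tperm (i, false) (ordS i, false) * tperm (i, true) (ordS i, true)
  else tperm (i, false) (i, true).

Definition weyl (n : nat) : {set signed_perm n} :=
  <<[set simple i | i in [set: 'I_n]]>>.

Definition is_length (n : nat) (w : signed_perm n) (k : nat) : Prop :=
  (exists2 s : seq 'I_n, size s = k & w = \prod_(i <- s) simple i) /\
  (forall s : seq 'I_n, w = \prod_(i <- s) simple i -> k <= size s).

Definition reflection (n : nat) (t : signed_perm n) : Prop :=
  exists2 w, w \in weyl n & exists i, t = simple i ^ w.

Definition bruhat_step (n : nat) (u w : signed_perm n) : Prop :=
  (exists2 t, reflection t & w = u * t) /\
  (exists k l, [/\ is_length u k, is_length w l & k < l]).

Definition bruhat_lt (n : nat) : relation (signed_perm n) :=
  clos_trans _ (@bruhat_step n).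

(* Rows and columns are counted from 0, so that the box (r, c) of the
   1-indexed picture, with c <= n - r + 1, is the pair (r - 1, c - 1), and its
   label s_(r+c-1) is simple (row + col). *)
Record box (n : nat) := Box {
  coords : 'I_n * 'I_n;
  coordsP : coords.1 + coords.2 < n
}.
HB.instance Definition _ (n : nat) := [isSub for @coords n].
HB.instance Definition _ (n : nat) := [Countable of box n by <:].
HB.instance Definition _ (n : nat) := [Finite of box n by <:].

Definition row (n : nat) (b : box n) : nat := (coords b).1.
Definition col (n : nat) (b : box n) : nat := (coords b).2.
Definition label (n : nat) (b : box n) : 'I_n := Ordinal (coordsP b).

Definition diagonal (n : nat) (b : box n) : bool := (row b + col b).+1 == n.

Definition cover (n : nat) : rel (box n) := fun a b =>
  (row b == row a) && (col b == (col a).+1)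
  || (row a == (row b).+1) && (col b == col a).

Definition ble (n : nat) : rel (box n) := connect (@cover n).
Definition blt (n : nat) : rel (box n) := fun a b => (a != b) && ble a b.

Definition order_ideal (n : nat) (O : {set box n}) : Prop :=
  forall a b, b \in O -> ble a b -> a \in O.

Definition interval_oo (n : nat) (x y : box n) : {set box n} :=
  [set z | blt x z && blt z y].
Definition interval_cc (n : nat) (x y : box n) : {set box n} :=
  [set z | ble x z && ble z y].

Definition linear_extension (n : nat) (C : {set box n}) (s : seq (box n)) :=
  perm_eq s (enum C) && pairwise (fun a b => ~~ blt b a) s.

Inductive symbol := Zero | Plus.

(* A diagram of shape C is a partial function on the boxes with domain C. *)
Definition diagram (n : nat) := {ffun box n -> option symbol}.

Definition shape (n : nat) (D : diagram n) : {set box n} :=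
  [set b | isSome (D b)].

Definition factor (n : nat) (D : diagram n) (b : box n) : signed_perm n :=
  if D b is Some Zero then simple (label b) else 1.

Definition v_along (n : nat) (D : diagram n) (s : seq (box n)) :
  signed_perm n := \prod_(b <- rev s) factor D b.

(* One linear extension of C: rows from bottom to top, each from left to
   right.  By v_along_indep below, v does not depend on this choice. *)
Definition reading_order (n : nat) (C : {set box n}) : seq (box n) :=
  sort (fun a b => (row b < row a) || (row a == row b) && (col a <= col b))
       (enum C).

Definition v (n : nat) (D : diagram n) : signed_perm n :=
  v_along D (reading_order (shape D)).

(* Here rev s is b_m, ..., b_1; splitting it as r1 ++ b :: r2 with size r1 = k-1
   makes b = b_(m+1-k) and the product over r1 equal to v_(k-1). *)
Definition gamma_along (n : nat) (D : diagram n) (s : seq (box n)) : Prop :=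
  forall r1 b r2, rev s = r1 ++ b :: r2 ->
    let u := \prod_(z <- r1) factor D z in
    bruhat_lt u (u * simple (label b)).

(* Swapping adjacent incomparable boxes of s swaps commuting simple reflections,
   so the condition does not depend on s. *)
Definition gamma_diagram (n : nat) (D : diagram n) : Prop :=
  forall s, linear_extension (shape D) s -> gamma_along D s.

Definition gamma_form (n : nat) (D Dp : diagram n) : Prop :=
  [/\ shape Dp = shape D, gamma_diagram Dp & v Dp = v D].

Inductive mark := Fixed of symbol | Unknown.

Definition pattern (n : nat) := {ffun box n -> option mark}.

Definition pattern_shape (n : nat) (S : pattern n) : {set box n} :=
  [set b | isSome (S b)].

Definition compatible (n : nat) (D : diagram n) (S : pattern n) : Prop :=
  shape D = pattern_shape S /\
  forall z a, S z = Some (Fixed a) -> D z = Some a.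

Definition add_zero (n : nat) (D : diagram n) (x : box n) : diagram n :=
  [ffun z => if z == x then Some Zero else D z].

Definition restrict (n : nat) (D : diagram n) (C : {set box n}) : diagram n :=
  [ffun z => if z \in C then D z else None].

Definition gamma_move (n : nat) (x y : box n) (S : pattern n) : Prop :=
  [/\ blt x y, pattern_shape S = interval_oo x y &
      forall D, compatible D S -> v (add_zero D x) = v (add_zero D y)].

Definition switch (a : symbol) : symbol := if a is Zero then Plus else Zero.

Definition performable (n : nat) (x y : box n) (S : pattern n)
    (D : diagram n) : Prop :=
  [/\ interval_cc x y \subset shape D, D y = Some Zero &
      compatible (restrict D (interval_oo x y)) S].

Definition perform (n : nat) (x y : box n) (D : diagram n) : diagram n :=
  [ffun z => if z == y then Some Plus
             else if z == x then omap switch (D z) else D z].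

Definition move_set (n : nat) := box n -> box n -> pattern n -> Prop.

Definition move_step (n : nat) (M : move_set n) : relation (diagram n) :=
  fun D D' => exists x y S,
    [/\ M x y S, performable x y S D & D' = perform x y D].

(* Dp is D_+, the unique Γ-diagram with the shape and the v of D. *)
Definition complete (n : nat) (M : move_set n) : Prop :=
  forall O : {set box n}, order_ideal O ->
  forall D : diagram n, shape D = O ->
  exists Dp, unique (gamma_form D) Dp /\ clos_refl_trans _ (move_step M) D Dp.

Definition complete_set_of_gamma_moves (n : nat) (M : move_set n) : Prop :=
  (forall x y S, M x y S -> gamma_move x y S) /\ complete M.

Definition fill (n : nat) (x y : box n) (P : pred (box n)) : pattern n :=
  [ffun z => if z \in interval_oo x y
             then Some (Fixed (if P z then Plus else Zero)) else None].

(* The third condition says that the lower right corner of [x, y] is a box; the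
   upper left corner always is one. *)
Definition rectangular_move (n : nat) : move_set n := fun x y S =>
  [/\ exists O, [/\ order_ideal O, x \in O & y \in O],
      blt x y,
      exists z : box n, row z = row x /\ col z = col y,
      row y < row x /\ col x < col y &
      S = fill x y (fun z => (row z == row y) && (col z == col x)
                             || (row z == row x) && (col z == col y))].

Definition diagonal_move (n : nat) : move_set n := fun x y S =>
  [/\ exists O, [/\ order_ideal O, x \in O & y \in O],
      blt x y,
      diagonal x /\ diagonal y &
      S = fill x y (fun z => (row z == row y) && (col z == col x))].

Lemma box_inj (n : nat) (a b : box n) : row a = row b -> col a = col b -> a = b.
Proof.
case: a b => [[i j] ?] [[k l] ?]; rewrite /row /col /= => ik jl.
by apply: val_inj => /=; congr (_, _); apply: val_inj.
Qed.

Lemma bleE (n : nat) (a b : box n) :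
  ble a b = (row b <= row a) && (col a <= col b).
Proof.
apply/idP/idP.
  move=> /connectP[p pth ->] {b}.
  elim: p a pth => [|c p IH] a /=; first by rewrite !leqnn.
  case/andP=> cov /IH; move: cov; rewrite /cover.
  move: (row _) (row _) (row _) (col _) (col _) (col _) => *; lia.
have [k] := ubnP ((row a - row b) + (col b - col a)).
elim: k a => // k IH a ltk ab.
have [ra|ra] := ltnP (row b) (row a).
  have a'lt : (row a).-1 < n by have : row a < n := ltn_ord _; lia.
  have a'P : (Ordinal a'lt, (coords a).2).1 + (Ordinal a'lt, (coords a).2).2 < n.
    by have : row a + col a < n := coordsP a; rewrite /= -/(col a); lia.
  pose a' : box n := Box a'P.
  have ra' : row a' = (row a).-1 by [].
  have ca' : col a' = col a by [].
  apply: connect_trans (IH a' _ _); last 2 first.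
  - by rewrite ra' ca'; lia.
  - by rewrite ra' ca'; lia.
  by apply: connect1; rewrite /cover ra' ca' eqxx andbT; lia.
have [ca|ca] := ltnP (col a) (col b).
  have a'lt : (col a).+1 < n by have : col b < n := ltn_ord _; lia.
  have a'P : ((coords a).1, Ordinal a'lt).1 + ((coords a).1, Ordinal a'lt).2 < n.
    by have : row b + col b < n := coordsP b; rewrite /= -/(row a); lia.
  pose a' : box n := Box a'P.
  have ra' : row a' = row a by [].
  have ca' : col a' = (col a).+1 by [].
  apply: connect_trans (IH a' _ _); last 2 first.
  - by rewrite ra' ca'; lia.
  - by rewrite ra' ca'; lia.
  by apply: connect1; rewrite /cover ra' ca' !eqxx.
suff -> : a = b by exact: connect0.
by apply: box_inj; lia.
Qed.

Lemma reading_orderP (n : nat) (C : {set box n}) :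
  linear_extension C (reading_order C).
Proof.
rewrite /linear_extension /reading_order; set le := (X in sort X).
rewrite perm_sort perm_refl /=.
have le_tr : transitive le by move=> b a c; rewrite /le; lia.
have le_tot : total le by move=> a b; rewrite /le; lia.
have := sort_sorted le_tot (enum C); rewrite (sorted_pairwise le_tr).
apply: sub_pairwise => a b leab; rewrite /blt bleE negb_and negbK.
case: (eqVneq b a) => //= neq; move: leab; rewrite /le.
suff : (row a != row b) || (col a != col b) by lia.
rewrite -negb_and; apply: contra neq => /andP[/eqP r /eqP c].
by apply/eqP/box_inj.
Qed.

Lemma simpleE (n : nat) (i : 'I_n) (p : 'I_n * bool) :
  simple i p =
  if i.+1 < n then
    (if p.1 == i then ordS i else if p.1 == ordS i then i else p.1, p.2)
  else (p.1, p.2 (+) (p.1 == i)).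
Proof.
case: p => j b; rewrite /simple /=; case: ifP => iP; last first.
  rewrite permE /= !xpair_eqE; case: eqVneq => [->|_]; case: b => //=.
have ne : i != ordS i by rewrite -val_eqE /= modn_small //; lia.
rewrite permM !permE /= !xpair_eqE.
have neS : ordS i == i = false by rewrite eq_sym (negPf ne).
case: (eqVneq j i) => [->|ji].
  by case: b; rewrite /= ?xpair_eqE ?andbT ?andbF ?eqxx ?neS //= ?(negPf ne).
case: (eqVneq j (ordS i)) => [->|jSi]; case: b => /=.
all: by do 3?[rewrite ?xpair_eqE ?andbT ?andbF ?eqxx ?(negPf ne) ?neS ?(negPf ji)
  ?(negPf jSi) /=].
Qed.

Lemma simple1 (n : nat) (i : 'I_n) (p : 'I_n * bool) :
  (simple i p).1 = (if i.+1 < n then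
    (if p.1 == i :> nat then i.+1
     else if p.1 == i.+1 :> nat then nat_of_ord i else p.1)
    else p.1) :> nat.
Proof.
rewrite simpleE; case: ifP => //= iP.
have Si : ordS i = i.+1 :> nat by rewrite /= modn_small.
have -> : (p.1 == ordS i) = (p.1 == i.+1 :> nat) by rewrite -val_eqE -Si.
by rewrite -val_eqE /=; do !case: ifP => //=.
Qed.

Lemma simple2 (n : nat) (i : 'I_n) (p : 'I_n * bool) :
  (simple i p).2 = p.2 (+) ((i.+1 == n) && (p.1 == i :> nat)).
Proof.
rewrite simpleE; case: ifP => /= iP.
  have -> : i.+1 == n = false by lia.
  by rewrite addbF.
have -> : i.+1 == n by have := ltn_ord i; lia.
by rewrite val_eqE.
Qed.

Lemma signed_perm_eq (n : nat) (u w : signed_perm n) :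
  (forall p, (u p).1 = (w p).1 :> nat) -> (forall p, (u p).2 = (w p).2) -> u = w.
Proof.
move=> h1 h2; apply/permP => p.
by apply/eqP; rewrite -pair_eqE /= h2 eqxx andbT -val_eqE /= h1.
Qed.

Local Ltac split_ifs := repeat match goal with
  |- context [if ?c then _ else _] =>
    lazymatch c with
    | context [if _ then _ else _] => fail
    | _ => let E := fresh "E" in case E: c; try (exfalso; lia)
    end
  end.
Local Ltac cox := apply: signed_perm_eq; let p := fresh "p" in intro p;
  rewrite ?(expgS, expg0, mulg1, permM, perm1, simple2, simple1);
  destruct p as [[? ?] []]; rewrite /=; split_ifs; lia.

Lemma simple_sq (n : nat) (i : 'I_n) : simple i ^+ 2 = 1.
Proof. have ? := ltn_ord i; cox. Qed.

Lemma simple_commute (n : nat) (i j : 'I_n) :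
  i.+1 < j -> commute (simple i) (simple j).
Proof. move=> ij; have ? := ltn_ord j; rewrite /commute; cox. Qed.

Lemma simple_braid3 (n : nat) (i j : 'I_n) :
  j = i.+1 :> nat -> j.+1 < n -> (simple i * simple j) ^+ 3 = 1.
Proof.
move=> ij jn; pose l := Ordinal jn.
have iP : i.+1 < n by lia.
have Ej : ordS i = j by apply: val_inj; rewrite /= modn_small.
have El : ordS j = l by apply: val_inj; rewrite /= modn_small.
have ne : [&& i != j, i != l & j != l] by rewrite -!val_eqE /= ij; lia.
case/and3P: ne => ne1 ne2 ne3.
have fi k b : simple i (k, b) =
  (if k == i then j else if k == j then i else k, b) by rewrite simpleE iP Ej.
have fj k b : simple j (k, b) =
  (if k == j then l else if k == l then j else k, b) by rewrite simpleE jn El.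
apply/permP => -[k b]; rewrite !expgS expg0 mulg1 !permM perm1.
have E := (eqxx, negPf ne1, negPf ne2, negPf ne3,
  eq_sym j i, eq_sym l i, eq_sym l j).
case: (eqVneq k i) => [->|ki]; first by do !rewrite (fi, fj) /= ?E.
case: (eqVneq k j) => [->|kj]; first by do !rewrite (fi, fj) /= ?E.
case: (eqVneq k l) => [->|kl]; first by do !rewrite (fi, fj) /= ?E.
by do !rewrite (fi, fj) /= ?(negPf ki, negPf kj, negPf kl).
Qed.

Lemma simple_braid4 (n : nat) (i j : 'I_n) :
  j = i.+1 :> nat -> j.+1 = n -> (simple i * simple j) ^+ 4 = 1.
Proof.
move=> ij jn.
have iP : i.+1 < n by lia.
have jP : (j.+1 < n) = false by lia.
have Ej : ordS i = j by apply: val_inj; rewrite /= modn_small.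
have ne : i != j by rewrite -val_eqE /= ij; lia.
have fi k b : simple i (k, b) =
  (if k == i then j else if k == j then i else k, b) by rewrite simpleE iP Ej.
have fj k b : simple j (k, b) = (k, b (+) (k == j)) by rewrite simpleE jP.
apply/permP => -[k b]; rewrite !expgS expg0 mulg1 !permM perm1.
have E := (eqxx, negPf ne, eq_sym j i).
case: (eqVneq k i) => [->|ki]; first by case: b; do !rewrite (fi, fj) /= ?E.
case: (eqVneq k j) => [->|kj]; first by case: b; do !rewrite (fi, fj) /= ?E.
by case: b; do !rewrite (fi, fj) /= ?(negPf ki, negPf kj).
Qed.

Lemma factor_commute (n : nat) (D : diagram n) (a b : box n) :
  ~~ blt a b -> ~~ blt b a -> commute (factor D a) (factor D b).
Proof.
case: (eqVneq a b) => [->|ne]; first by [].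
have ne' : b != a by rewrite eq_sym.
rewrite /blt !bleE ne ne' /= => nab nba.
rewrite /factor; case: (D a) => [[]|]; case: (D b) => [[]|]; try by
  [exact: commute1 | exact/commute_sym/commute1].
have la : label a = row a + col a :> nat by [].
have lb : label b = row b + col b :> nat by [].
have [h|h] := ltnP (label a).+1 (label b); first exact: simple_commute.
by apply/commute_sym/simple_commute; rewrite la lb in h *; lia.
Qed.

Lemma v_along_indep (n : nat) (D : diagram n) (C : {set box n})
    (s s' : seq (box n)) :
  linear_extension C s -> linear_extension C s' -> v_along D s = v_along D s'.
Proof.
move=> /andP[ps os] /andP[ps' os'].
have {ps ps'} : perm_eq s s' by rewrite (perm_trans ps) // perm_sym.
rewrite /v_along; elim: s s' os os' => [|a s IH] s' os os' ss'.
  by rewrite perm_sym in ss'; rewrite (perm_nilP ss').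
have as' : a \in s' by rewrite -(perm_mem ss') mem_head.
case/splitPr: as' os' ss' => p1 p2 os' ss'.
move: ss'; rewrite perm_sym -cat1s perm_catCA perm_cons perm_sym => ss'.
move: os => /= /andP[aP os].
move: os'; rewrite pairwise_cat /= => /and3P[rel12 o1 /andP[a2 o2]].
have rel12' : allrel (fun x y => ~~ blt y x) p1 p2.
  by apply/allrelP => x y xp yp; apply: (allrelP rel12) => //; rewrite inE yp orbT.
have os' : pairwise (fun x y => ~~ blt y x) (p1 ++ p2).
  by rewrite pairwise_cat rel12' o1 o2.
rewrite rev_cons -cats1 big_cat /= big_seq1 (IH _ os os' ss').
rewrite !rev_cat rev_cons -cats1 !big_cat /= big_seq1 -!mulgA; congr (_ * _).
apply/commute_sym; rewrite big_seq; apply: big_rec => [|b x]; first exact: commute1.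
rewrite mem_rev => bp; apply/commuteM/factor_commute.
  by apply: (allrelP rel12); rewrite ?mem_head.
by apply: (allP aP); rewrite (perm_mem ss') mem_cat bp.
Qed.

(* Main.v *)
(* A diagram is read as a system of signed pipes travelling north-east: a pipe
   goes straight through a 0 and turns at a +, and at a diagonal box it enters
   from the left and leaves upwards, changing sign when the box is 0.  A move
   (x, y, S) preserves v because the two pipes leaving x are led to y by the
   filling S.  When no move can be performed, no 0 has both a + to its left in
   its row and a + below it in its column, and no diagonal 0 has a + to its left
   in its row.  Then the pipe leaving a box upwards never changes sign, and the
   one leaving it to the right never crosses it before becoming negative, so
   that the next simple reflection always increases the length: the diagram is a
   Γ-diagram.  Moves terminate since each of them removes a 0 or pushes it
   down in Q. *)
Require Import Defs.
From mathcomp Require Import zify.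

Set Implicit Arguments.
Unset Strict Implicit.
Unset Printing Implicit Defensive.

Local Open Scope group_scope.

Local Ltac split_ifs := repeat match goal with
  | h : context [if ?c then _ else _] |- _ =>
    lazymatch c with
    | context [if _ then _ else _] => fail
    | _ => let E := fresh "E" in case E: c h => h; try (exfalso; lia)
    end
  | |- context [if ?c then _ else _] =>
    lazymatch c with
    | context [if _ then _ else _] => fail
    | _ => let E := fresh "E" in case E: c; try (exfalso; lia)
    end
  end.

(** * Boxes in coordinates *)

Lemma bltE n (a b : box n) :
  blt a b = [&& row b <= row a, col a <= col b &
                (row a != row b) || (col a != col b)].
Proof.
rewrite /blt bleE; case: eqVneq => [->|ne] /=; first by rewrite !eqxx !andbF.
suff -> : (row a != row b) || (col a != col b) by rewrite andbT.
rewrite -negb_and; apply: contra ne => /andP[/eqP r /eqP c].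
by apply/eqP/box_inj.
Qed.

Lemma boxP n (r c : nat) :
  r + c < n -> exists b : box n, row b = r /\ col b = c.
Proof.
move=> h; have hr : r < n by lia. have hc : c < n by lia.
by exists (@Box n (Ordinal hr, Ordinal hc) h).
Qed.

Lemma box_lt n (b : box n) : row b + col b < n.
Proof. exact: coordsP. Qed.

Lemma labelE n (b : box n) : label b = row b + col b :> nat.
Proof. by []. Qed.

Lemma box_eqE n (a b : box n) : (a == b) = (row a == row b) && (col a == col b).
Proof.
apply/eqP/andP => [->|[/eqP r /eqP c]]; first by rewrite !eqxx.
exact: box_inj.
Qed.

Lemma pt_eq n (p q : 'I_n * bool) : p.1 = q.1 :> nat -> p.2 = q.2 -> p = q.
Proof. by case: p q => [i b] [j c] /= e ->; congr (_, _); apply: val_inj. Qed.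

(** * Roots and reflections of the signed permutation group *)

Definition neg_pt n (p : 'I_n * bool) : 'I_n * bool := (p.1, ~~ p.2).

(* Position in the order e_0, ..., e_(n-1), -e_(n-1), ..., -e_0. *)
Definition key n (p : 'I_n * bool) : nat :=
  if p.2 then (n + n).-1 - p.1 else p.1.

(** The reflection in the root [p - q], up to a scalar. For [q = -p] the two transpositions coincide
    and their product would be trivial, so only one is kept. *)
Definition root_refl n (p q : 'I_n * bool) : signed_perm n :=
  if q == neg_pt p then tperm p q else tperm p q * tperm (neg_pt p) (neg_pt q).

(** The successor of [e_i] in the order given by [key], also for the last index, where it is
    [-e_(n-1)]. *)
Definition next_pt n (i : 'I_n) : 'I_n * bool :=
  if i.+1 < n then (ordS i, false) else (i, true).

(** The type [signed_perm n] contains every permutation of the 2n points; this condition singles out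
    the genuine signed permutations. *)
Definition neg_equivariant n (w : signed_perm n) :=
  forall p, w (neg_pt p) = neg_pt (w p).

Lemma key_inj n : injective (@key n).
Proof.
case=> [i b] [j c]; rewrite /key /= => h.
have hi := ltn_ord i; have hj := ltn_ord j.
have bc : b = c by move: h; case: b; case: c => //= *; lia.
by rewrite bc in h *; congr (_, _); apply: val_inj; move: h; case: c {bc} => /=; lia.
Qed.

Lemma simple_root_refl n (i : 'I_n) : simple i = root_refl (i, false) (next_pt i).
Proof.
rewrite /simple /root_refl /next_pt; case: ifP => _; last by rewrite /neg_pt /= eqxx.
by rewrite /neg_pt /= xpair_eqE andbF.
Qed.

Lemma root_reflJ n (w : signed_perm n) (p q : 'I_n * bool) :
  neg_equivariant w -> root_refl p q ^ w = root_refl (w p) (w q).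
Proof.
move=> ow; rewrite /root_refl -ow (inj_eq perm_inj); case: ifP => _.
  exact: tpermJ.
by rewrite conjMg !tpermJ !ow.
Qed.

Lemma neg_equivariant_simple n (i : 'I_n) : neg_equivariant (simple i).
Proof.
move=> [j b]; rewrite !simpleE /neg_pt /=; case: ifP => //= _.
by rewrite addNb.
Qed.

Lemma neg_equivariantM n (u w : signed_perm n) :
  neg_equivariant u -> neg_equivariant w -> neg_equivariant (u * w).
Proof. by move=> ou ow p; rewrite !permM ou ow. Qed.

Lemma neg_equivariant1 n : neg_equivariant (1 : signed_perm n).
Proof. by move=> p; rewrite !perm1. Qed.

Lemma neg_equivariantV n (w : signed_perm n) : neg_equivariant w -> neg_equivariant w^-1.
Proof. by move=> ow p; apply: (@perm_inj _ w); rewrite ow !permKV. Qed.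

Lemma neg_equivariant_word n (s : seq 'I_n) : neg_equivariant (\prod_(i <- s) simple i).
Proof.
elim/big_rec: _ => [|i w _ ow]; first exact: neg_equivariant1.
exact: neg_equivariantM (@neg_equivariant_simple _ _) ow.
Qed.

Lemma simpleK n (i : 'I_n) : simple i * simple i = 1.
Proof. by have := simple_sq i; rewrite expgS expg1. Qed.

Lemma simpleV n (i : 'I_n) : (simple i)^-1 = simple i.
Proof. by apply/eqP; rewrite eq_invg_mul simpleK. Qed.

Lemma simple_fst n (i : 'I_n) : simple i (i, false) = next_pt i.
Proof. by rewrite simpleE /next_pt /= !eqxx; case: ifP. Qed.

Lemma simple_next n (i : 'I_n) : simple i (next_pt i) = (i, false).
Proof. by rewrite -simple_fst -permM simpleK perm1. Qed.

(** In the order of [key], [simple i] reverses only the adjacent pair [e_i], [next_pt i] and the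
    negative of that pair, and both define the same reflection. *)
Lemma simple_flip n (i : 'I_n) (p q : 'I_n * bool) :
  key p < key q -> key (simple i q) < key (simple i p) -> simple i = root_refl p q.
Proof.
move=> pq; rewrite /key !simple1 !simple2 => qp.
have hi := ltn_ord i.
suff [[-> ->]|[-> ->]] : (p = (i, false) /\ q = next_pt i) \/
    (p = neg_pt (next_pt i) /\ q = (i, true)); first exact: simple_root_refl.
  rewrite simple_root_refl /root_refl /next_pt.
  case: (i.+1 < n); rewrite /neg_pt /= ?eqxx // !xpair_eqE /= ?andbF.
  rewrite conjgC tpermJ !tpermD ?xpair_eqE ?andbF //.
  by rewrite tpermC [tperm (ordS i, false) _]tpermC.
rewrite /key in pq.
have nx1 : (next_pt i).1 = (if i.+1 < n then i.+1 else i) :> nat.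
  by rewrite /next_pt; case: ifP => //= h; rewrite modn_small.
have nx2 : (next_pt i).2 = (i.+1 == n).
  by rewrite /next_pt; case: ifP => //= h; lia.
have [hp hq] := (ltn_ord p.1, ltn_ord q.1).
suff H : (p.2 = false /\ p.1 = i :> nat) /\ (q.1 = (next_pt i).1 :> nat /\ q.2 = (next_pt i).2)
   \/ (p.1 = (next_pt i).1 :> nat /\ p.2 = ~~ (next_pt i).2) /\ (q.1 = i :> nat /\ q.2 = true).
  by case: H => [[[h1 h2] [h3 h4]]|[[h1 h2] [h3 h4]]]; [left|right]; split; apply: pt_eq.
rewrite nx1 nx2.
case: p pq qp hp => [p1 []]; case: q hq => [q1 []] /= hq pq qp hp;
  split_ifs; lia.
Qed.

Lemma key_lt n (p q : 'I_n * bool) :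
  p.2 = false -> q.2 || (p.1 < q.1) -> key p < key q.
Proof.
rewrite /key => ->; have := ltn_ord p.1; have := ltn_ord q.1.
by case: (q.2) => //=; lia.
Qed.

(* The strong exchange condition: the root swapped by [simple i] becomes
   negative at some letter of the word, and that letter can be deleted. *)
Lemma word_exchange n (i : 'I_n) (s : seq 'I_n) :
  let w := \prod_(j <- s) simple j in
  key (w^-1 (next_pt i)) < key (w^-1 (i, false)) ->
  exists2 s', size s' < size s & w * simple i = \prod_(j <- s') simple j.
Proof.
elim: s => [|j s IH] /=.
  (* The empty word flips nothing: the two keys are [i] and [i + 1]. *)
  rewrite big_nil invg1 !perm1 /key /next_pt /=.
  by have := ltn_ord i; case: (ltnP i.+1 n) => /= h; rewrite ?modn_small //; lia.
rewrite big_cons; set w := \prod_(j <- s) _ in IH *.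
rewrite invMg !permM simpleV => flip.
have [lt|le] := ltnP (key (w^-1 (next_pt i))) (key (w^-1 (i, false))).
  have [s' szs' ws'] := IH lt; exists (j :: s') => //.
  by rewrite big_cons -ws' mulgA.
have {}le : key (w^-1 (i, false)) < key (w^-1 (next_pt i)).
  rewrite ltn_neqAle le andbT; apply/eqP => /key_inj e.
  by rewrite e ltnn in flip.
exists s => //; rewrite -/w.
have sj := simple_flip le flip.
(* The root of [simple i], pulled back by [w], is the one flipped at the letter [j]; hence
   [simple j * w] equals [w * simple i], and the letter [j] cancels. *)
have sji : simple j ^ w = simple i.
  by rewrite sj root_reflJ ?permKV -?simple_root_refl //; exact: neg_equivariant_word.
by rewrite -sji -mulgA -conjgC mulgA simpleK mul1g.
Qed.

(** * Length and Bruhat order *)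

Lemma length_ex n (s : seq 'I_n) : exists k, is_length (\prod_(j <- s) simple j) k.
Proof.
pose w := \prod_(j <- s) simple j.
pose P k := [exists t : k.-tuple 'I_n, w == \prod_(j <- t) simple j].
have exP : exists k, P k.
  by exists (size s); apply/existsP; exists (in_tuple s).
case: (ex_minnP exP) => k /existsP[t /eqP wt] kmin; exists k; split.
  by exists t; rewrite ?size_tuple.
by move=> t' wt'; apply: kmin; apply/existsP; exists (in_tuple t'); apply/eqP.
Qed.

Lemma length_uniq n (w : signed_perm n) k l :
  is_length w k -> is_length w l -> k = l.
Proof.
move=> [[s <- ws] kmin] [[t <- wt] lmin]; apply/eqP.
by rewrite eqn_leq kmin // lmin.
Qed.

Lemma bruhat_lt_length n (u w : signed_perm n) :
  bruhat_lt u w -> exists k l, [/\ is_length u k, is_length w l & k < l].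
Proof.
elim=> {u w} [u w [_] //|u x w _ [k [l [uk xl kl]]] _ [l' [m [xl' wm lm]]]].
exists k, m; split=> //; apply: (ltn_trans kl).
by rewrite (length_uniq xl xl').
Qed.

Lemma bruhat_ltxx n (u : signed_perm n) : ~ bruhat_lt u u.
Proof.
by case/bruhat_lt_length => k [l [uk /(length_uniq uk) ->]]; rewrite ltnn.
Qed.

(** The hypothesis says that [u * simple i] makes the root of [simple i] negative. Exchange in a
    shortest word of [u * simple i] then gives a strictly shorter word of [u]. *)
Lemma bruhat_lt_simple n (i : 'I_n) (s : seq 'I_n) :
  let u := \prod_(j <- s) simple j in
  key (u^-1 (i, false)) < key (u^-1 (next_pt i)) ->
  bruhat_lt u (u * simple i).
Proof.
move=> u lt; apply: t_step; split.
  by exists (simple i) => //; exists 1; [exact: group1 | exists i; rewrite conjg1].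
have usE : u * simple i = \prod_(j <- rcons s i) simple j.
  by rewrite -cats1 big_cat big_seq1.
have [[k uk] [l ul]] := (length_ex s, length_ex (rcons s i)).
rewrite -usE in ul; exists k, l; split=> //.
case: (ul) => [[t <- ust] _]; case: (uk) => _; set v0 := u in uk *.
have [|t' szt' ut'] := @word_exchange n i t.
  by rewrite -ust invMg !permM simpleV simple_fst simple_next.
move=> /(_ t') kt'; apply: leq_ltn_trans szt'; apply: kt'.
by rewrite -ut' -ust -mulgA simpleK mulg1.
Qed.

(** * Factors of a diagram and uniqueness of the Γ-diagram *)

Definition is_zero n (D : diagram n) (b : box n) : bool :=
  if D b is Some Zero then true else false.

Definition is_plus n (D : diagram n) (b : box n) : bool :=
  if D b is Some Plus then true else false.

Lemma factorE n (D : diagram n) b :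
  factor D b = if is_zero D b then simple (label b) else 1.
Proof. by rewrite /factor /is_zero; case: (D b) => [[]|]. Qed.

Lemma is_zeroP n (D : diagram n) b : reflect (D b = Some Zero) (is_zero D b).
Proof. by rewrite /is_zero; case: (D b) => [[]|]; constructor. Qed.

Lemma is_plusE n (D : diagram n) b :
  b \in shape D -> is_plus D b = ~~ is_zero D b.
Proof. by rewrite inE /is_plus /is_zero; case: (D b) => [[]|]. Qed.

Lemma factors_word n (D : diagram n) (r : seq (box n)) :
  exists s : seq 'I_n, \prod_(z <- r) factor D z = \prod_(j <- s) simple j.
Proof.
exists [seq label z | z <- r & is_zero D z].
rewrite big_map big_filter; elim: r => [|z r IH]; first by rewrite !big_nil.
by rewrite !big_cons IH factorE; case: ifP => //; rewrite mul1g.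
Qed.

(** Every factor is an involution. The inverse thus reads the boxes from low to high, which is the
    direction in which pipes travel. *)
Lemma factors_inv n (D : diagram n) (r : seq (box n)) :
  (\prod_(z <- rev r) factor D z)^-1 = \prod_(z <- r) factor D z.
Proof.
elim: r => [|z r IH]; first by rewrite !big_nil invg1.
rewrite rev_cons -cats1 big_cat big_seq1 invMg IH big_cons factorE.
by case: ifP => _; rewrite ?invg1 ?simpleV.
Qed.

(* Each factor, read off from the end of the product, is forced by the
   direction of the Bruhat comparison. *)
Lemma gamma_factors_uniq n (D1 D2 : diagram n) (r : seq (box n)) :
  gamma_along D1 (rev r) -> gamma_along D2 (rev r) ->
  \prod_(z <- r) factor D1 z = \prod_(z <- r) factor D2 z ->
  {in r, forall z, is_zero D1 z = is_zero D2 z}.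
Proof.
rewrite /gamma_along revK; elim/last_ind: r => [//|r b IH] g1 g2.
have sub (D : diagram n) :
    (forall r1 b0 r2, rcons r b = r1 ++ b0 :: r2 ->
      let u := \prod_(z <- r1) factor D z in
      bruhat_lt u (u * simple (label b0))) ->
    forall r1 b0 r2, r = r1 ++ b0 :: r2 ->
      let u := \prod_(z <- r1) factor D z in
      bruhat_lt u (u * simple (label b0)).
  by move=> g r1 b0 r2 e; apply: (g r1 b0 (rcons r2 b)); rewrite e rcons_cat.
have := g2 r b [::]; have := g1 r b [::].
rewrite -cats1 !big_cat /= !big_seq1 !factorE => /(_ erefl) lt1 /(_ erefl) lt2.
set u1 := \prod_(z <- r) factor D1 z in lt1 *.
set u2 := \prod_(z <- r) factor D2 z in lt2 *.
move=> e.
suff zb : is_zero D1 b = is_zero D2 b.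
  move=> z; rewrite mem_cat mem_seq1 => /orP[zr|/eqP-> //].
  apply: IH zr; [exact: sub g1 | exact: sub g2 |].
  by move: e; rewrite zb => /mulIg.
case: (is_zero D1 b) (is_zero D2 b) e => [] [] //; rewrite ?mulg1 => e.
  have e' : u2 * simple (label b) = u1 by rewrite -e -mulgA simpleK mulg1.
  by rewrite e in lt1; rewrite e' in lt2; case: (bruhat_ltxx (t_trans _ _ _ _ _ lt1 lt2)).
have e' : u1 * simple (label b) = u2 by rewrite e -mulgA simpleK mulg1.
by rewrite e' in lt1; rewrite -e in lt2; case: (bruhat_ltxx (t_trans _ _ _ _ _ lt1 lt2)).
Qed.

Lemma gamma_uniq n (D1 D2 : diagram n) :
  shape D1 = shape D2 -> gamma_diagram D1 -> gamma_diagram D2 -> v D1 = v D2 ->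
  D1 = D2.
Proof.
move=> sh g1 g2; rewrite /v /v_along sh => ev.
have le := reading_orderP (shape D2).
have key0 := @gamma_factors_uniq n D1 D2 (rev (reading_order (shape D2))).
rewrite revK in key0.
have {}key0 := key0 (g1 _ _) (g2 _ le) ev; rewrite sh in key0.
apply/ffunP => b; have [bC|bC] := boolP (b \in shape D2); last first.
  have := bC; rewrite -{1}sh !inE; have := bC; rewrite inE.
  by case: (D1 b) => //; case: (D2 b).
have := key0 le b; rewrite mem_rev (perm_mem (proj1 (andP le))) mem_enum bC.
have : b \in shape D1 by rewrite sh.
move: bC; rewrite !inE /is_zero.
by case: (D1 b) => [[]|] //; case: (D2 b) => [[]|] // _ _ /(_ isT).
Qed.

(** * Pipes through a diagram *)

(* The boxes of C still ahead of a pipe, in the order in which it meets them. *)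
Definition upper_list n (C : {set box n}) (R : seq (box n)) : Prop :=
  [/\ {subset R <= C}, uniq R, pairwise (fun a b => ~~ blt b a) R &
      forall a w, w \in R -> a \in C -> blt w a -> a \in R].

Lemma upper_list_cons n (C : {set box n}) w R :
  upper_list C (w :: R) ->
  [/\ upper_list C R, w \in C, w \notin R & {in R, forall a, ~~ blt a w}].
Proof.
case=> sub /andP[wR uR] /andP[/allP wmin pR] up; split=> //; last first.
  by apply: sub; rewrite mem_head.
split=> // [a aR|a b bR aC ba]; first by apply: sub; rewrite inE aR orbT.
have := up a b; rewrite !inE bR orbT => /(_ isT aC ba) /orP[/eqP e|//].
by have := wmin b bR; rewrite /= -e ba.
Qed.

(** These are the boxes whose label can move position [i]. They form a north-east staircase on two
    neighbouring antidiagonals, hence a chain. *)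
Definition touches n (w : box n) (i : nat) : bool :=
  (row w + col w == i) || ((row w + col w).+1 == i).

Lemma touches_blt n (a b : box n) i :
  touches b i -> touches a i -> a != b -> ~~ blt a b -> blt b a.
Proof. by rewrite box_eqE /touches !bltE; lia. Qed.

(** Since the boxes touching [i] form a chain, those of them still ahead are recorded by a single
    cut point [z], the last box that the pipe has met. *)
Definition frontier n (C : {set box n}) (R : seq (box n)) z (i : nat) : Prop :=
  forall w, w \in C -> touches w i -> (w \in R) = blt z w.

(* A pipe sits at position [p.1], having left the box z through its right side
   if d, and through its top side otherwise. *)
Definition pipe_at n (C : {set box n}) x R (p : 'I_n * bool) z (d : bool) : Prop :=
  [/\ p.1 = row z + col z + d :> nat, ble x z & frontier C R z p.1].

Definition turn n (D : diagram n) w (d : bool) : bool :=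
  if is_zero D w then d && ~~ diagonal w else ~~ d.

Definition enters n (w z : box n) (d : bool) : Prop :=
  row z = row w + ~~ d /\ col w = col z + d.

(** If [w] touches the position of the pipe, then [w] is the neighbour that the pipe heads for: that
    neighbour lies between [z] and [w], so it is in [C] and still ahead, and [w] is minimal among
    the boxes ahead. Otherwise the factor fixes the pipe. *)
Lemma pipe_step n (D : diagram n) (C : {set box n}) x R w p z d :
  (forall a b, b \in C -> blt x a -> ble a b -> a \in C) ->
  upper_list C (w :: R) -> pipe_at C x (w :: R) p z d ->
  [/\ factor D w p = p, ~~ touches w p.1 & pipe_at C x R p z d] \/
  [/\ enters w z d, pipe_at C x R (factor D w p) w (turn D w d) &
      (factor D w p).2 = p.2 (+) [&& d, is_zero D w & diagonal w]].
Proof.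
move=> conv upR [pz xz fr].
have [upR' wC wR wmin] := upper_list_cons upR.
have [sub _ _ up] := upR.
have pn := ltn_ord p.1; have wn := box_lt w; have zn := box_lt z.
have [tw|tw] := boolP (touches w p.1); [right|left]; last first.
  split=> //.
    rewrite factorE; case: ifP => _; rewrite ?perm1 //.
    move: tw; rewrite /touches negb_or => /andP[t1 t2].
    apply/eqP; rewrite -pair_eqE /pair_eq /= -val_eqE /= simple1 simple2 labelE.
    by case: (p.2); split_ifs; lia.
  split=> // a aC ta; have := fr a aC ta; rewrite inE; case: eqVneq => //= e.
  by rewrite e (negPf tw) in ta.
have zw : blt z w by rewrite -fr // mem_head.
have en : enters w z d.
  (* The box that the pipe heads for. In row 0 with [d] false the subtraction would give [z] itself,
     but then no box above [z] touches the position, contrary to [tw]. *)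
  have [a [ra ca]] : exists a : box n, row a = row z - ~~ d /\ col a = col z + d.
    by apply: boxP; case: d pz => /=; move: zn; lia.
  have az : [&& blt z a, ble a w & touches a p.1].
    move: zw tw; rewrite !bltE bleE /touches ra ca pz.
    by case: (d); lia.
  case/and3P: az => za aw ta.
  have xa : blt x a by move: xz za; rewrite !bltE bleE; lia.
  have aC : a \in C by apply: conv wC xa aw.
  have := fr a aC ta; rewrite za inE => /orP[/eqP e|aR].
    rewrite /enters -e ra ca; move: zw tw; rewrite bltE /touches -e ra ca pz.
    by case: (d); lia.
  have := wmin a aR; rewrite /blt aw andbT negbK => /eqP e.
  by rewrite -e aR in wR.
have [rz cw] := en; split=> //; last first.
  rewrite factorE; case: (is_zero D w); rewrite ?perm1 ?andbF ?addbF //.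
  rewrite simple2 labelE /diagonal pz; congr (_ (+) _).
  by case: (d) rz cw => /=; lia.
have pos : (factor D w p).1 = row w + col w + turn D w d :> nat.
  rewrite factorE /turn /diagonal; case: (is_zero D w); rewrite ?perm1; last first.
    by rewrite pz; case: (d) rz cw => /=; lia.
  by rewrite simple1 labelE pz; case: (d) rz cw => /=; split_ifs; lia.
split=> //; first by move: xz zw; rewrite bltE !bleE; lia.
rewrite pos => a aC ta; apply/idP/idP => [aR|wa].
  apply: touches_blt _ ta _ (wmin a aR); last by apply: contraNneq wR => <-.
  by rewrite /touches; case: (turn _ _ _); rewrite ?addn0 ?addn1 eqxx ?orbT.
have := up a w; rewrite !inE eqxx => /(_ isT aC wa) /orP[/eqP e|//].
by rewrite e /blt eqxx in wa.
Qed.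

(** Induction over the boxes ahead: an invariant of the last box, the exit side and the sign need
    only be checked at the boxes that the pipe really enters. *)
Lemma pipe_trace n (D : diagram n) (C : {set box n}) x
    (J : box n -> bool -> bool -> Prop) :
  (forall a b, b \in C -> blt x a -> ble a b -> a \in C) ->
  (forall w z d t, w \in C -> ble x z -> enters w z d -> J z d t ->
     J w (turn D w d) (t (+) [&& d, is_zero D w & diagonal w])) ->
  forall R p z d, upper_list C R -> pipe_at C x R p z d -> J z d p.2 ->
  exists z' d', let p' := (\prod_(w <- R) factor D w) p in
    pipe_at C x [::] p' z' d' /\ J z' d' p'.2.
Proof.
move=> conv stepJ; elim=> [|w R IH] p z d upR pip Jz.
  by exists z, d; rewrite big_nil perm1.
have [upR' wC _ _] := upper_list_cons upR.
rewrite big_cons permM.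
have [[-> _ pip']|[en pip' e]] := pipe_step D conv upR pip; first exact: IH pip' Jz.
apply: IH pip' _ => //; rewrite e; apply: stepJ en Jz => //.
by case: pip.
Qed.

(** * Diagrams without forbidden configurations are Γ-diagrams *)

Definition corner_free n (D : diagram n) : Prop :=
  forall y a b, is_zero D y -> is_plus D a -> is_plus D b ->
    row a = row y -> col a < col y -> col b = col y -> row y < row b -> False.

Definition diagonal_free n (D : diagram n) : Prop :=
  forall y a, is_zero D y -> diagonal y -> is_plus D a ->
    row a = row y -> col a < col y -> False.

(** Here and in [plus_below] the box [z] itself counts, as when the pipe has just turned at [z]. *)
Definition plus_left n (D : diagram n) (z : box n) : Prop :=
  exists2 a, is_plus D a & row a = row z /\ col a <= col z.

Definition plus_below n (D : diagram n) (z : box n) : Prop :=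
  exists2 a, is_plus D a & col a = col z /\ row z <= row a.

Section Avoiding.

Variables (n : nat) (D : diagram n).
Hypotheses (shD : order_ideal (shape D)) (cD : corner_free D) (dD : diagonal_free D).

(* Invariants of the pipe leaving a box upwards, and of the one leaving it to
   the right: the latter becomes negative at most once. *)
Let up_pipe (z : box n) (d t : bool) : Prop := t = false /\ (d -> plus_left D z).
Let right_pipe (z : box n) (d t : bool) : Prop :=
  if d then plus_left D z \/ t = false else plus_below D z \/ t = true.

Let enters_right w z : enters w z true -> plus_left D z ->
  exists2 a, is_plus D a & row a = row w /\ col a < col w.
Proof. by case=> /= r c [a pa [ra ca]]; exists a => //; lia. Qed.

Let enters_up w z : enters w z false -> plus_below D z ->
  exists2 a, is_plus D a & col a = col w /\ row w < row a.
Proof. by case=> /= r c [a pa [ra ca]]; exists a => //; lia. Qed.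

(** A sign change needs a diagonal zero entered from the left; the [+] already to the left in that
    row makes this impossible by [diagonal_free]. *)
Let up_pipe_step w z d t : w \in shape D -> enters w z d -> up_pipe z d t ->
  up_pipe w (turn D w d) (t (+) [&& d, is_zero D w & diagonal w]).
Proof.
move=> wD en [-> pl]; rewrite /turn; case zw: (is_zero D w) => /=; last first.
  rewrite andbF; split=> // _; exists w; last by [].
  by rewrite is_plusE // zw.
case: d en pl => [en /(_ isT) pl|_ _] //=.
have [a pa [ra ca]] := enters_right en pl.
case dw: (diagonal w) => /=; first by case: (dD zw dw pa ra ca).
by split=> // _; exists a => //; lia.
Qed.

(** Before its first turn the pipe may reach a diagonal zero and become negative. After any later
    turn to the right there is a [+] to its left, and [diagonal_free] forbids a second change. *)
Let right_pipe_step w z d t : w \in shape D -> enters w z d -> right_pipe z d t ->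
  right_pipe w (turn D w d) (t (+) [&& d, is_zero D w & diagonal w]) /\
  (t -> t (+) [&& d, is_zero D w & diagonal w]).
Proof.
move=> wD en; rewrite /turn; case zw: (is_zero D w) => /=; last first.
  have pw : is_plus D w by rewrite is_plusE // zw.
  rewrite andbF addbF => _; split=> //.
  by case: d {en}; left; exists w.
case: d en => en /=; last first.
  rewrite addbF => -[pb|->]; split=> //; last by right.
  by have [a pa [ca ra]] := enters_up en pb; left; exists a => //; lia.
case=> [pl|->].
  have [a pa [ra ca]] := enters_right en pl.
  case dw: (diagonal w) => /=; first by case: (dD zw dw pa ra ca).
  by rewrite addbF; split=> //; left; exists a => //; lia.
by case: (diagonal w) => /=; split=> //; right.
Qed.

Let shape_conv x : forall a b, b \in shape D -> blt x a -> ble a b -> a \in shape D.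
Proof. by move=> a b bD _ ab; apply: shD bD ab. Qed.

(** A box exchanges only two adjacent positions, so the order can change only where both pipes meet
    the same box. At a [+] they bounce off each other; at a zero they would cross, and [corner_free]
    rules this out while [q] is positive. *)
Lemma pipes_ordered x R (p q : 'I_n * bool) z d z' d' :
  upper_list (shape D) R ->
  pipe_at (shape D) x R p z d -> up_pipe z d p.2 ->
  pipe_at (shape D) x R q z' d' -> right_pipe z' d' q.2 ->
  q.2 || (p.1 < q.1) ->
  let p' := (\prod_(w <- R) factor D w) p in
  let q' := (\prod_(w <- R) factor D w) q in
  p'.2 = false /\ (q'.2 || (p'.1 < q'.1)).
Proof.
elim: R p q z d z' d' => [|w R IH] p q z d z' d' upR pp Jp pq Jq lt /=.
  by rewrite !big_nil !perm1; case: Jp.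
have [upR' wC _ _] := upper_list_cons upR.
rewrite !big_cons !permM.
have [[-> tp pp']|[enp pp' ep]] := pipe_step D (@shape_conv x) upR pp;
have [[-> tq pq']|[enq pq' eq]] := pipe_step D (@shape_conv x) upR pq.
- exact: IH pp' Jp pq' Jq lt.
- have [Jq' mono] := right_pipe_step wC enq Jq.
  apply: (IH _ _ _ _ _ _ upR' pp' Jp pq'); first by rewrite eq.
  rewrite eq; case/orP: lt => [/mono -> //|lt].
  case: pq' pq enq => + _ _ [+ _ _] [+ +].
  by move: tp; rewrite /touches; case: (turn _ _ _); case: (d'); lia.
- have Jp' := up_pipe_step wC enp Jp.
  apply: (IH _ _ _ _ _ _ upR' pp' _ pq' Jq); first by rewrite ep.
  case/orP: lt => [-> //|lt]; apply/orP; right.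
  case: pp' pp enp => + _ _ [+ _ _] [+ +].
  by move: tq; rewrite /touches; case: (turn _ _ _); case: (d); lia.
have Jp' := up_pipe_step wC enp Jp.
have [Jq' mono] := right_pipe_step wC enq Jq.
apply: (IH _ _ _ _ _ _ upR' pp' _ pq'); rewrite ?ep ?eq //.
case/orP: lt => [/mono -> //|lt]; case qt: (q.2); first by rewrite -qt mono.
apply/orP; right.
have [[{}ep _ _] [{}eq _ _]] := (pp, pq).
(* As [p] is at the lower position, it enters [w] from the left and [q] enters from below. *)
have [dt df] : d = true /\ d' = false.
  by case: enp enq => + + [+ +]; case: (d) ep; case: (d') eq => /=; lia.
subst d d'; case: pp' pq' => [-> _ _] [-> _ _].
rewrite /turn; case zw: (is_zero D w) => /=; last by lia.
have [_ /(_ isT) pl] := Jp; have [a pa [ra ca]] := enters_right enp pl.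
have [pb|] := Jq; last by rewrite qt.
have [b pb' [cb rb]] := enters_up enq pb.
by case: (cD zw pa pb' ra ca cb rb).
Qed.

(** The Bruhat comparison at [b] compares the two ends of its simple root after the boxes read later
    than [b], that is, the two pipes that start at [b]. *)
Lemma avoiding_gamma : gamma_diagram D.
Proof.
move=> s /andP[ps os] r1 b r2 es u.
have es' : s = rev r2 ++ b :: rev r1 by rewrite -[s]revK es rev_cat rev_cons cat_rcons.
have us : uniq s by rewrite (perm_uniq ps) enum_uniq.
have ms w : (w \in s) = (w \in shape D) by rewrite (perm_mem ps) mem_enum.
move: us os ms; rewrite es' cat_uniq pairwise_cat /= => /and3P[_ nr2 /andP[nb ur1]].
case/and3P=> rel2 _ /andP[bmin pr1] ms.
have upl a : a \in shape D -> (a \notin rev r2) && (a != b) -> a \in rev r1.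
  by rewrite -ms mem_cat inE => /or3P[h|/eqP->|//] /andP[]; rewrite ?h ?eqxx.
have upR : upper_list (shape D) (rev r1).
  split=> // [a ar1|a w wr1 aD wa].
    by rewrite -ms mem_cat inE ar1 !orbT.
  apply: upl => //; apply/andP; split.
    apply/negP => ar2; have := allrelP rel2 a w ar2.
    by rewrite inE wr1 orbT wa => /(_ isT).
  by apply/negP => /eqP e; have := allP bmin w wr1; rewrite /= -e wa.
have bD : b \in shape D by rewrite -ms mem_cat mem_head orbT.
have fr i : touches b i -> frontier (shape D) (rev r1) b i.
  move=> tb a aD ta; apply/idP/idP => [ar1|ba].
    apply: touches_blt tb ta _ (allP bmin a ar1).
    by apply: contraNneq nb => <-.
  apply: upl => //; apply/andP; split; last first.
    by apply/negP => /eqP e; rewrite e /blt eqxx in ba.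
  by apply/negP => ar2; have := allrelP rel2 a b ar2; rewrite mem_head ba => /(_ isT).
have [w uw] := factors_word D r1.
rewrite /u uw; apply: bruhat_lt_simple; rewrite -uw -[r1]revK factors_inv.
set t := \prod_(_ <- _) _.
have bn := box_lt b.
have pp : pipe_at (shape D) b (rev r1) (label b, false) b false.
  split; rewrite ?labelE ?addn0 ?bleE ?leqnn //.
  by apply: fr; rewrite /touches eqxx.
have up0 : up_pipe b false false by split.
(* At a diagonal box the second point is the negative of the first, so it is enough that the upward
   pipe stays positive. *)
have [db|db] := boolP (diagonal b).
  have [z' [d' [_ [pf _]]]] :
      exists z' d', pipe_at (shape D) b [::] (t (label b, false)) z' d' /\
                    up_pipe z' d' (t (label b, false)).2.
    apply: (pipe_trace (D := D) (J := up_pipe) (@shape_conv b) _ upR pp up0).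
    by move=> ? ? ? ? wC _; apply: up_pipe_step.
  have -> : next_pt (label b) = neg_pt (label b, false).
    by rewrite /next_pt labelE; move: db; rewrite /diagonal => /eqP->; rewrite ltnn.
  have ot : neg_equivariant t.
    by rewrite /t; have [s' ->] := factors_word D (rev r1); apply: neg_equivariant_word.
  by rewrite ot; apply: key_lt; rewrite // /neg_pt /= pf.
have lt : (label b).+1 < n by rewrite labelE; move: db; rewrite /diagonal; lia.
have nx : next_pt (label b) = (ordS (label b), false) by rewrite /next_pt lt.
have ordE : ordS (label b) = (row b + col b).+1 :> nat by rewrite /= modn_small.
have pq : pipe_at (shape D) b (rev r1) (next_pt (label b)) b true.
  rewrite nx; split; rewrite ?bleE ?leqnn // /fst ordE ?addn1 //.
  by apply: fr; rewrite /touches eqxx orbT.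
have [||pf lt'] := pipes_ordered upR pp up0 pq; last exact: key_lt.
- by rewrite nx; right.
- by rewrite nx /= modn_small.
Qed.

End Avoiding.

(** * Linear extensions adapted to an interval, and invariance of [v] under moves *)

Lemma linear_extension_cat n (C1 C2 : {set box n}) s1 s2 :
  linear_extension C1 s1 -> linear_extension C2 s2 ->
  (forall a b, a \in C1 -> b \in C2 -> ~~ ble b a) ->
  linear_extension (C1 :|: C2) (s1 ++ s2).
Proof.
move=> /andP[p1 o1] /andP[p2 o2] sep.
have m1 a : (a \in s1) = (a \in C1) by rewrite (perm_mem p1) mem_enum.
have m2 a : (a \in s2) = (a \in C2) by rewrite (perm_mem p2) mem_enum.
apply/andP; split.
  apply: uniq_perm; last by move=> a; rewrite mem_cat mem_enum in_setU m1 m2.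
    rewrite cat_uniq (perm_uniq p1) (perm_uniq p2) !enum_uniq /= andbT.
    apply/hasPn => a; rewrite m2 => aC2; apply/negP => /=; rewrite m1 => aC1.
    by have := sep a a aC1 aC2; rewrite bleE !leqnn.
  exact: enum_uniq.
rewrite pairwise_cat o1 o2 !andbT; apply/allrelP => a b; rewrite m1 m2 => aC bC.
by rewrite /blt negb_and sep ?orbT.
Qed.

Lemma linear_extension1 n (x : box n) : linear_extension [set x] [:: x].
Proof. by rewrite /linear_extension enum_set1 perm_refl. Qed.

Lemma mem_reading n (C : {set box n}) z : (z \in reading_order C) = (z \in C).
Proof. by have /andP[/perm_mem-> _] := reading_orderP C; rewrite mem_enum. Qed.

Lemma v_linear n (D : diagram n) s : linear_extension (shape D) s -> v D = v_along D s.
Proof. by move=> ls; apply: v_along_indep (reading_orderP _) ls. Qed.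

Lemma v_along_cat n (D : diagram n) s1 s2 :
  v_along D (s1 ++ s2) = v_along D s2 * v_along D s1.
Proof. by rewrite /v_along rev_cat big_cat. Qed.

Lemma v_along1 n (D : diagram n) x : v_along D [:: x] = factor D x.
Proof. by rewrite /v_along big_seq1. Qed.

Lemma eq_v_along n (D D' : diagram n) s :
  {in s, D =1 D'} -> v_along D s = v_along D' s.
Proof.
move=> e; rewrite /v_along !big_seq; apply: eq_bigr => z.
by rewrite mem_rev => zs; rewrite /factor e.
Qed.

Lemma blexx n (x : box n) : ble x x.
Proof. by rewrite bleE !leqnn. Qed.

Lemma bltxx n (x : box n) : blt x x = false.
Proof. by rewrite /blt eqxx. Qed.

Lemma bltW n (x y : box n) : blt x y -> ble x y.
Proof. by case/andP. Qed.

Lemma blt_nle n (x y : box n) : blt x y -> ~~ ble y x.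
Proof. by rewrite bltE bleE; lia. Qed.

Lemma shape_add_zero n (D : diagram n) x : shape (add_zero D x) = x |: shape D.
Proof. by apply/setP => z; rewrite !inE ffunE; case: eqP. Qed.

Definition interior n (D : diagram n) (x y : box n) : signed_perm n :=
  v_along D (reading_order (interval_oo x y)).

Lemma v_add_zero_low n (D : diagram n) (x y : box n) :
  shape D = interval_oo x y ->
  v (add_zero D x) = interior D x y * simple (label x).
Proof.
move=> sh; rewrite (@v_linear _ _ ([:: x] ++ reading_order (interval_oo x y))).
  rewrite v_along_cat v_along1 /factor ffunE eqxx; congr (_ * _).
  apply: eq_v_along => z; rewrite mem_reading inE ffunE => /andP[xz _].
  by case: eqP xz => // ->; rewrite bltxx.
rewrite shape_add_zero sh; apply: linear_extension_cat (linear_extension1 x) (reading_orderP _) _.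
by move=> a b; rewrite !inE => /eqP-> /andP[xb _]; apply: blt_nle.
Qed.

Lemma v_add_zero_high n (D : diagram n) (x y : box n) :
  shape D = interval_oo x y ->
  v (add_zero D y) = simple (label y) * interior D x y.
Proof.
move=> sh; rewrite (@v_linear _ _ (reading_order (interval_oo x y) ++ [:: y])).
  rewrite v_along_cat v_along1 /factor ffunE eqxx; congr (_ * _).
  apply: eq_v_along => z; rewrite mem_reading inE ffunE => /andP[_ zy].
  by case: eqP zy => // ->; rewrite bltxx.
rewrite shape_add_zero sh setUC.
apply: linear_extension_cat (reading_orderP _) (linear_extension1 y) _.
by move=> a b; rewrite !inE => /andP[_ ay] /eqP->; apply: blt_nle.
Qed.

Lemma restrict_interior n (D : diagram n) (x y : box n) :
  interior (restrict D (interval_oo x y)) x y = interior D x y.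
Proof. by apply: eq_v_along => z; rewrite mem_reading ffunE => ->. Qed.

Lemma interval_ccE n (x y : box n) : blt x y ->
  interval_cc x y = x |: (interval_oo x y :|: [set y]).
Proof.
move=> xy; apply/setP => z; rewrite !inE !box_eqE !bltE !bleE.
by move: xy; rewrite bltE; lia.
Qed.

Lemma perform_shape n (D : diagram n) (x y : box n) :
  interval_cc x y \subset shape D -> blt x y -> shape (perform x y D) = shape D.
Proof.
move=> sub xy; apply/setP => z; rewrite !inE ffunE.
have yD : y \in shape D by apply: (subsetP sub); rewrite inE blexx bltW.
case: eqP => [->|_]; first by move: yD; rewrite inE => ->.
by case: eqP => [->|_] //; case: (D x).
Qed.

(** In a linear extension where [[x, y]] is contiguous, the Γ-move identity lets the zero at [y]
    pass through the interior and become a factor at [x]. *)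
Lemma perform_v n (D : diagram n) (x y : box n) S :
  order_ideal (shape D) -> gamma_move x y S -> performable x y S D ->
  v (perform x y D) = v D.
Proof.
move=> idl [xy _ mv] [sub Dy comp].
have shR : shape (restrict D (interval_oo x y)) = interval_oo x y.
  apply/setP => z; rewrite inE ffunE; case: ifP => // zI.
  suff : z \in shape D by rewrite inE.
  by apply: (subsetP sub); rewrite interval_ccE // in_setU in_setU zI orbT.
have comm : interior D x y * simple (label x) = simple (label y) * interior D x y.
  have := mv _ comp.
  by rewrite (v_add_zero_low shR) (v_add_zero_high shR) restrict_interior.
(* [A] can be read before [x], and [B] after [y]. *)
pose A := shape D :&: [set z | ~~ ble x z].
pose B := shape D :&: [set z | ble x z && ~~ ble z y].
have lin : linear_extension (shape D) (reading_order A ++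
    ([:: x] ++ (reading_order (interval_oo x y) ++ [:: y])) ++ reading_order B).
  have -> : shape D = A :|: (interval_cc x y :|: B).
    apply/setP => z; rewrite !inE.
    have [zC|] := boolP (z \in interval_cc x y).
      have := subsetP sub z zC; move: zC; rewrite !inE => -> ->.
      by rewrite orbT.
    by rewrite inE; case: (ble x z); case: (ble z y) => //=; rewrite ?andbT ?andbF ?orbF.
  apply: linear_extension_cat; first exact: reading_orderP.
    apply: linear_extension_cat; last 2 first.
    - exact: reading_orderP.
    - move=> a b; rewrite !inE => /andP[_ ay] /and3P[_ _ by']; apply: contra by'.
      by move=> ba; apply: connect_trans ba ay.
    rewrite interval_ccE //; apply: linear_extension_cat (linear_extension1 x) _ _.
      apply: linear_extension_cat (reading_orderP _) (linear_extension1 y) _.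
      by move=> a b; rewrite !inE => /andP[_ ay] /eqP->; apply: blt_nle.
    by move=> a b; rewrite !inE => /eqP-> /orP[/andP[xb _]|/eqP->]; apply: blt_nle.
  move=> a b; rewrite !inE => /andP[_ xa] xb; apply: contra xa.
  have {}xb : ble x b by case/orP: xb => [|/andP[_]] /andP[].
  exact: connect_trans.
have lin' := lin; rewrite -(perform_shape sub xy) in lin'.
rewrite (v_linear lin) (v_linear lin').
have out (C : {set box n}) : x \notin C -> y \notin C ->
    v_along (perform x y D) (reading_order C) = v_along D (reading_order C).
  move=> xC yC; apply: eq_v_along => z; rewrite mem_reading ffunE => zC.
  case: eqP => [e|_]; first by rewrite -e zC in yC.
  by case: eqP => [e|_] //; rewrite -e zC in xC.
rewrite !v_along_cat !v_along1 !out;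
  try by rewrite !inE ?blexx ?bltxx ?(bltW xy) /= ?andbF.
rewrite -/(interior D x y); congr (_ * _ * _).
have xny : x == y = false by case/andP: xy => /negPf.
have xD : x \in shape D by apply: (subsetP sub); rewrite inE blexx bltW.
(* The factor arriving at [x] cancels a zero there or replaces a [+] by a zero. *)
move: xD; rewrite inE /factor !ffunE !eqxx xny Dy mul1g -comm.
case: (D x) => [[]|] //= _; rewrite ?mulg1 //.
by rewrite -mulgA simpleK mulg1.
Qed.

(** * The rectangular and diagonal moves are Γ-moves *)

Lemma upper_list_reading n (C : {set box n}) : upper_list C (reading_order C).
Proof.
have /andP[p o] := reading_orderP C.
split=> // [z||a w _ aC _]; rewrite ?mem_reading //.
by rewrite (perm_uniq p) enum_uniq.
Qed.

Lemma oo_conv n (x y : box n) a b :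
  b \in interval_oo x y -> blt x a -> ble a b -> a \in interval_oo x y.
Proof. by rewrite !inE !bltE bleE; lia. Qed.

Lemma interior_inv n (D : diagram n) (x y : box n) :
  (interior D x y)^-1 = \prod_(z <- reading_order (interval_oo x y)) factor D z.
Proof. by rewrite /interior /v_along factors_inv. Qed.

Lemma oo_pipe_at n (x y : box n) (p : 'I_n * bool) (d : bool) :
  p.1 = row x + col x + d :> nat ->
  pipe_at (interval_oo x y) x (reading_order (interval_oo x y)) p x d.
Proof.
move=> e; split=> //; first exact: blexx.
by move=> w wC _; rewrite mem_reading wC; move: wC; rewrite inE => /andP[->].
Qed.

(** If the pipes carry the root of [x] to that of [y], conjugation by the interior relates the two
    reflections. *)
Lemma interior_conj n (D : diagram n) (x y : box n) :
  (interior D x y)^-1 (label x, false) = (label y, false) ->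
  (interior D x y)^-1 (next_pt (label x)) = next_pt (label y) ->
  interior D x y * simple (label x) = simple (label y) * interior D x y.
Proof.
move=> e1 e2; rewrite [RHS]conjgC; congr (_ * _).
rewrite !simple_root_refl root_reflJ; last first.
  rewrite /interior /v_along; set r := rev _.
  by have [s ->] := factors_word D r; apply: neg_equivariant_word.
by rewrite -e1 -e2 !permKV.
Qed.

(* The pipe leaving x upwards turns right at the upper left corner. *)
Lemma up_trace n (D : diagram n) (x y : box n) :
  row y < row x -> col x < col y ->
  (forall z, z \in interval_oo x y -> row z = row y \/ col z = col x ->
     is_zero D z = ~~ ((row z == row y) && (col z == col x))) ->
  (interior D x y)^-1 (label x, false) = (label y, false).
Proof.
move=> rxy cxy zD; rewrite interior_inv.
pose J (z : box n) (d t : bool) := t = false /\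
  if d then row z = row y /\ col z < col y else col z = col x /\ row y < row z.
have [//|||z [d [[pz xz fr] [pt Jz]]]] :=
    @pipe_trace n D (interval_oo x y) x J (@oo_conv n x y) _ _ (label x, false) x
      false (upper_list_reading _) (oo_pipe_at _ _) _.
- move=> w z d t wC xz [rz cw] [-> Jz].
  have yn := box_lt y; have := wC; rewrite inE !bltE => wxy.
  have [rw|cw'] : row w = row y \/ col w = col x by case: (d) rz cw Jz => /=; lia.
    rewrite /J /turn /diagonal (zD w wC (or_introl rw)) rw eqxx /=.
    case: d rz cw Jz => /= rz cw Jz; last by case: eqP; rewrite /= ?andbF; lia.
    have -> : col w == col x = false by move: xz; rewrite bleE; lia.
    have -> : (row y + col w).+1 == n = false by lia.
    by rewrite /=; lia.
  rewrite /J /turn /diagonal (zD w wC (or_intror cw')) cw' eqxx andbT.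
  case: d rz cw Jz => /= rz cw Jz; first by move: xz; rewrite bleE; lia.
  by case: eqP => /=; lia.
- by rewrite /= addn0.
- by split.
apply: pt_eq => //; rewrite [LHS]pz [RHS]labelE.
(* No box of the interval remains ahead. Applied to the box in front of the pipe, this forces that
   box to be [y]. *)
have next (r c : nat) : r + c < n ->
    [&& row y <= r, r <= row x, col x <= c, c <= col y &
      [|| r != row x | c != col x] && [|| r != row y | c != col y]] ->
    (r + c == row z + col z + d) || ((r + c).+1 == row z + col z + d) ->
    ~~ [&& r <= row z, col z <= c & (row z != r) || (col z != c)].
  move=> rc; have [w [<- <-]] := boxP rc => wC tw.
  rewrite -bltE; have := fr w; rewrite in_nil pz => /(_ _ tw) <- //.
  by rewrite inE !bltE; move: wC; lia.
have := box_lt z; have := box_lt y; move: xz; rewrite bleE.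
case: d Jz {pz fr} next => /= -[e1 e2] next xz yn zn; last first.
  by have := next (row z).-1 (col z); lia.
by have := next (row z) (col z).+1; lia.
Qed.

(** The pipe leaving [x] to the right turns upwards at the lower right corner. Only this corner can
    be diagonal on its path, and it carries a [+], so the sign persists. *)
Lemma right_trace n (D : diagram n) (x y : box n) :
  row y < row x -> col x < col y -> row x + col y < n ->
  (forall z, z \in interval_oo x y -> row z = row x \/ col z = col y ->
     is_zero D z = ~~ ((row z == row x) && (col z == col y))) ->
  (interior D x y)^-1 (next_pt (label x)) = next_pt (label y).
Proof.
move=> rxy cxy xyn zD; rewrite interior_inv.
have nextE (z : box n) : (row z + col z).+1 < n -> (next_pt (label z)).2 = false /\
    (next_pt (label z)).1 = (row z + col z).+1 :> nat.
  by move=> h; rewrite /next_pt labelE h /= modn_small.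
have [|x2 x1] := nextE x; first by lia.
have [|y2 y1] := nextE y; first by lia.
pose J (z : box n) (d t : bool) := t = false /\
  if d then row z = row x /\ col z < col y else col z = col y /\ row y < row z.
have [//|||z [d [[pz xz fr] [pt Jz]]]] :=
    @pipe_trace n D (interval_oo x y) x J (@oo_conv n x y) _ _ (next_pt (label x)) x
      true (upper_list_reading _) (oo_pipe_at _ _) _.
- move=> w z d t wC xz [rz cw] [-> Jz].
  have := wC; rewrite inE !bltE => wxy.
  have [rw|cw'] : row w = row x \/ col w = col y by case: (d) rz cw Jz => /=; lia.
    rewrite /J /turn /diagonal (zD w wC (or_introl rw)) rw eqxx /=.
    case: d rz cw Jz => /= rz cw Jz; last by move: xz; rewrite bleE; lia.
    case: eqP => /= e; first by lia.
    have -> : (row x + col w).+1 == n = false by lia.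
    by rewrite /=; lia.
  rewrite /J /turn /diagonal (zD w wC (or_intror cw')) cw' eqxx andbT.
  case: d rz cw Jz => /= rz cw Jz; last by move: xz; rewrite bleE; case: eqP => /=; lia.
  have -> : row w == row x by lia.
  by rewrite /=; lia.
- by rewrite x1 addn1.
- by rewrite x2; split.
apply: pt_eq; rewrite ?y2 // [LHS]pz y1.
have next (r c : nat) : r + c < n ->
    [&& row y <= r, r <= row x, col x <= c, c <= col y &
      [|| r != row x | c != col x] && [|| r != row y | c != col y]] ->
    (r + c == row z + col z + d) || ((r + c).+1 == row z + col z + d) ->
    ~~ [&& r <= row z, col z <= c & (row z != r) || (col z != c)].
  move=> rc; have [w [<- <-]] := boxP rc => wC tw.
  rewrite -bltE; have := fr w; rewrite in_nil pz => /(_ _ tw) <- //.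
  by rewrite inE !bltE; move: wC; lia.
have := box_lt z; have := box_lt y; move: xz; rewrite bleE.
case: d Jz {pz fr} next => /= -[e1 e2] next xz yn zn; last first.
  by have := next (row z).-1 (col z); lia.
by have := next (row z) (col z).+1; lia.
Qed.

Lemma fill_shape n (x y : box n) P : pattern_shape (fill x y P) = interval_oo x y.
Proof. by apply/setP => z; rewrite inE ffunE; case: ifP. Qed.

Lemma compatible_fill n (D : diagram n) (x y : box n) P :
  compatible D (fill x y P) ->
  {in interval_oo x y, forall z, is_zero D z = ~~ P z}.
Proof.
move=> [_ c] z zI; have := c z; rewrite ffunE zI => /(_ _ erefl).
by rewrite /is_zero => ->; case: ifP.
Qed.

Lemma fill_gamma_move n (x y : box n) P :
  blt x y ->
  (forall D, compatible D (fill x y P) ->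
     (interior D x y)^-1 (label x, false) = (label y, false) /\
     (interior D x y)^-1 (next_pt (label x)) = next_pt (label y)) ->
  gamma_move x y (fill x y P).
Proof.
move=> xy tr; split=> // [|D comp]; first exact: fill_shape.
have sh : shape D = interval_oo x y by case: comp => -> _; rewrite fill_shape.
rewrite (v_add_zero_low sh) (v_add_zero_high sh).
by have [] := tr D comp; apply: interior_conj.
Qed.

Lemma rectangular_gamma_move n (x y : box n) S :
  rectangular_move x y S -> gamma_move x y S.
Proof.
move=> [_ xy [z0 [rz0 cz0]] [rxy cxy] ->].
have xyn : row x + col y < n by rewrite -rz0 -cz0; apply: box_lt.
apply: fill_gamma_move => // D /compatible_fill zD; split.
  by apply: up_trace => // z zI h; rewrite zD //; case: h; lia.
by apply: right_trace => // z zI h; rewrite zD //; case: h; lia.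
Qed.

(** On the diagonal [next_pt] is the negative of the first point, so equivariance deduces the second
    pipe from the first. *)
Lemma diagonal_gamma_move n (x y : box n) S :
  diagonal_move x y S -> gamma_move x y S.
Proof.
move=> [_ xy [dx dy] ->]; apply: fill_gamma_move => // D /compatible_fill zD.
have [rxy cxy] : row y < row x /\ col x < col y.
  by move: xy dx dy; rewrite bltE /diagonal; lia.
have tr : (interior D x y)^-1 (label x, false) = (label y, false).
  by apply: up_trace => // z zI h; rewrite zD.
have nextE (z : box n) : diagonal z -> next_pt (label z) = neg_pt (label z, false).
  by rewrite /next_pt labelE /diagonal => /eqP ->; rewrite ltnn.
split=> //; rewrite !nextE // -tr; apply: neg_equivariantV.
rewrite /interior /v_along; set r := rev _.
by have [s ->] := factors_word D r; apply: neg_equivariant_word.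
Qed.

(** * Finding a performable move *)

Definition rect_or_diag n : move_set n := fun x y S =>
  rectangular_move x y S \/ diagonal_move x y S.

Lemma fill_performable n (D : diagram n) (x y : box n) P :
  order_ideal (shape D) -> is_zero D y ->
  {in interval_oo x y, forall z, is_plus D z = P z} ->
  performable x y (fill x y P) D.
Proof.
move=> idl /is_zeroP Dy pD.
have sub : interval_cc x y \subset shape D.
  apply/subsetP => z; rewrite inE => /andP[_ zy].
  by apply: idl zy; rewrite inE Dy.
have oo z : z \in interval_oo x y -> D z = Some (if P z then Plus else Zero).
  move=> zI; have zD : z \in shape D.
    apply: (subsetP sub); move: zI; rewrite !inE => /andP[/bltW -> /bltW ->] //.
  rewrite -pD //; move: zD; rewrite inE /is_plus; by case: (D z) => [[]|].
split=> //; split.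
  apply/setP => z; rewrite fill_shape inE ffunE; case: ifP => // zI.
  by rewrite oo.
move=> z a; rewrite !ffunE; case: ifP => // zI [<-]; exact: oo.
Qed.

Lemma plus_or_zero n (D : diagram n) (a b : box n) :
  order_ideal (shape D) -> b \in shape D -> ble a b -> is_plus D a \/ is_zero D a.
Proof.
move=> idl bD ab; have aD := idl a b bD ab.
by rewrite is_plusE //; case: (is_zero D a); [right|left].
Qed.

Lemma is_zero_shape n (D : diagram n) (b : box n) : is_zero D b -> b \in shape D.
Proof. by rewrite inE => /is_zeroP ->. Qed.

(** Take a forbidden corner, and let [x] complete its rectangle. If the interval has no further [+],
    the rectangular move can be performed; any further [+] yields a smaller corner. *)
Lemma corner_move n (D : diagram n) (y a b : box n) :
  order_ideal (shape D) -> is_zero D y -> is_plus D a -> is_plus D b ->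
  row a = row y -> col a < col y -> col b = col y -> row y < row b ->
  exists D', move_step (@rect_or_diag n) D D'.
Proof.
move=> idl.
have [k] := ubnP ((row b - row y) + (col y - col a)).
elim: k y a b => // k IH y a b ltk zy pa pb ra ca cb rb.
have yD := is_zero_shape zy.
have bn := box_lt b.
have [x [rx cx]] : exists x : box n, row x = row b /\ col x = col a.
  by apply: boxP; lia.
pose P (z : box n) := (row z == row y) && (col z == col x)
                      || (row z == row x) && (col z == col y).
have [/existsP[z /and3P[zI pz nPz]]|none] :=
    boolP [exists z, [&& z \in interval_oo x y, is_plus D z & ~~ P z]].
  move: zI nPz; rewrite inE !bltE /P rx cx => zI nPz.
  have [rzy|rzy] := eqVneq (row z) (row y).
    by apply: (IH y z b) => //; lia.
  have [czy|czy] := eqVneq (col z) (col y).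
    by apply: (IH y a z) => //; lia.
  (* For [z] above [x] in its column, the box [y'] in the row of [z] and column of [y] either
     replaces [b] as a [+] or replaces [y] as a zero, with [z] in place of [a]. *)
  have [cza|cza] := eqVneq (col z) (col a).
    have [y' [ry' cy']] : exists y' : box n, row y' = row z /\ col y' = col y.
      by apply: boxP; lia.
    have [||p'|z'] := @plus_or_zero n D y' y idl => //; first by rewrite bleE; lia.
      by apply: (IH y a y') => //; lia.
    by apply: (IH y' z b) => //; lia.
  (* For all other [z], the box of row [y] above [z] replaces [a] if it is a [+], and otherwise
     replaces [y], with [z] as the new [b]. *)
  have [y' [ry' cy']] : exists y' : box n, row y' = row y /\ col y' = col z.
    by apply: boxP; have := box_lt y; lia.
  have [||p'|z'] := @plus_or_zero n D y' y idl => //; first by rewrite bleE; lia.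
    by apply: (IH y y' b) => //; lia.
  by apply: (IH y' a z) => //; lia.
have xy : blt x y by rewrite bltE; lia.
exists (perform x y D), x, y, (fill x y P); split=> //.
  left; split=> //.
  - by exists (shape D); split=> //; apply: idl yD (bltW xy).
  - by exists b; split.
  - by lia.
apply: fill_performable => // z zI; apply/idP/idP => [pz|].
  apply: contraNT none => nPz; apply/existsP; exists z.
  by rewrite zI pz.
case/orP=> /andP[/eqP r /eqP c].
  by rewrite (_ : z = a) //; apply: box_inj; lia.
by rewrite (_ : z = b) //; apply: box_inj; lia.
Qed.

(** The same descent with [x] the diagonal box in the column of [a]; a further [+] leads to a
    shorter diagonal configuration or to a forbidden corner. *)
Lemma diagonal_corner_move n (D : diagram n) (y a : box n) :
  order_ideal (shape D) -> is_zero D y -> diagonal y -> is_plus D a ->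
  row a = row y -> col a < col y ->
  exists D', move_step (@rect_or_diag n) D D'.
Proof.
move=> idl.
have [k] := ubnP (col y - col a).
elim: k y a => // k IH y a ltk zy dy pa ra ca.
have yD := is_zero_shape zy.
have := dy; rewrite /diagonal => /eqP dyE.
have [x [rx cx]] : exists x : box n, row x = n.-1 - col a /\ col x = col a.
  by apply: boxP; lia.
have dx : diagonal x by rewrite /diagonal; lia.
pose P (z : box n) := (row z == row y) && (col z == col x).
have [/existsP[z /and3P[zI pz nPz]]|none] :=
    boolP [exists z, [&& z \in interval_oo x y, is_plus D z & ~~ P z]].
  move: zI nPz; rewrite inE !bltE /P rx cx => zI nPz.
  have zn := box_lt z.
  have [rzy|rzy] := eqVneq (row z) (row y).
    by apply: (IH y z) => //; lia.
  (* Look at the box of row [y] above [u]: as a [+] it is closer to [y] than [a], and as a zero it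
     forms a corner with [a] and [u]. *)
  have corner u : is_plus D u -> row y < row u -> col a < col u < col y ->
      exists D', move_step (@rect_or_diag n) D D'.
    move=> pu ru cu.
    have [y' [ry' cy']] : exists y' : box n, row y' = row y /\ col y' = col u.
      by apply: boxP; lia.
    have [||p'|z'] := @plus_or_zero n D y' y idl => //; first by rewrite bleE; lia.
      by apply: (IH y y') => //; lia.
    by apply: (corner_move idl z' pa pu); lia.
  have [cza|cza] := eqVneq (col z) (col a); last by apply: (corner z) => //; lia.
  (* The diagonal box in the row of [z]: a [+] there is covered by [corner], and a zero gives a
     shorter configuration with [z]. *)
  have [y' [ry' cy']] : exists y' : box n, row y' = row z /\ col y' = n.-1 - row z.
    by apply: boxP; lia.
  have [||p'|z'] := @plus_or_zero n D y' y idl => //; first by rewrite bleE; lia.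
    by apply: (corner y') => //; lia.
  by apply: (IH y' z) => //; rewrite /diagonal; lia.
have xy : blt x y by rewrite bltE; lia.
exists (perform x y D), x, y, (fill x y P); split=> //.
  right; split=> //.
  by exists (shape D); split=> //; apply: idl yD (bltW xy).
apply: fill_performable => // z zI; apply/idP/idP => [pz|].
  apply: contraNT none => nPz; apply/existsP; exists z.
  by rewrite zI pz.
case/andP=> /eqP r /eqP c.
by rewrite (_ : z = a) //; apply: box_inj; lia.
Qed.

Lemma move_or_gamma n (D : diagram n) :
  order_ideal (shape D) ->
  (exists D', move_step (@rect_or_diag n) D D') \/ gamma_diagram D.
Proof.
move=> idl.
pose bad1 := [exists y, exists a, exists b,
  [&& is_zero D y, is_plus D a, is_plus D b, row a == row y, col a < col y,
      col b == col y & row y < row b]].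
pose bad2 := [exists y, exists a,
  [&& is_zero D y, diagonal y, is_plus D a, row a == row y & col a < col y]].
have [/existsP[y /existsP[a /existsP[b]]]|none1] := boolP bad1.
  case/and5P=> zy pa pb /eqP ra /and3P[ca /eqP cb rb]; left.
  exact: (corner_move idl zy pa pb).
have [/existsP[y /existsP[a]]|none2] := boolP bad2.
  case/and5P=> zy dy pa /eqP ra ca; left.
  exact: (diagonal_corner_move idl zy dy pa).
right; apply: avoiding_gamma => //.
  move=> y a b zy pa pb ra ca cb rb; case/negP: none1.
  apply/existsP; exists y; apply/existsP; exists a; apply/existsP; exists b.
  by rewrite zy pa pb ra cb !eqxx ca rb.
move=> y a zy dy pa ra ca; case/negP: none2.
apply/existsP; exists y; apply/existsP; exists a.
by rewrite zy dy pa ra eqxx ca.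
Qed.

(** * Termination and completeness *)

(* A move deletes the zero at y and creates at most one at x < y. *)
Definition zero_weight n (D : diagram n) : nat :=
  \sum_(z : box n | is_zero D z) (n - row z + col z).

Lemma perform_weight n (D : diagram n) (x y : box n) :
  blt x y -> is_zero D y -> zero_weight (perform x y D) < zero_weight D.
Proof.
move=> xy zy; have xny : x != y by case/andP: xy.
pose f (E : diagram n) z := if is_zero E z then n - row z + col z else 0.
have split_xy E : zero_weight E =
    f E y + (f E x + \sum_(z | (z != y) && (z != x)) f E z).
  by rewrite /zero_weight big_mkcond (bigD1 y) //= (bigD1 x).
rewrite !split_xy {1 4}/f zy /is_zero ffunE eqxx add0n.
rewrite (eq_bigr (f D)); last first.
  by move=> z /andP[zny znx]; rewrite /f /is_zero ffunE (negPf zny) (negPf znx).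
rewrite addnA ltn_add2r.
(* The weight of a box increases strictly along the order; as rows are less than [n], the
   subtraction does not truncate. *)
have : n - row x + col x < n - row y + col y.
  by have := box_lt x; move: xy; rewrite bltE; lia.
by rewrite /f; case: ifP => _; case: ifP => _; lia.
Qed.

Lemma rect_or_diag_gamma_move n (x y : box n) S :
  rect_or_diag x y S -> gamma_move x y S.
Proof.
by case; [apply: rectangular_gamma_move | apply: diagonal_gamma_move].
Qed.

(** Induction on [zero_weight]: each step keeps the shape and [v], and a diagram without a step is
    already a Γ-diagram. *)
Lemma gamma_reachable n (D : diagram n) :
  order_ideal (shape D) ->
  exists Dp, gamma_form D Dp /\ clos_refl_trans _ (move_step (@rect_or_diag n)) D Dp.
Proof.
have [k] := ubnP (zero_weight D).
elim: k D => // k IH D ltk idl.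
have [[D' stepD]|gD] := move_or_gamma idl; last first.
  by exists D; split; [split | apply: rt_refl].
have [x [y [S [M pf eD']]]] := stepD.
have gm := rect_or_diag_gamma_move M; have [xy _ _] := gm.
have [sub /is_zeroP zy _] := pf.
have sh : shape D' = shape D by rewrite eD' perform_shape.
have [||Dp [[sh' g' v'] steps]] := IH D'; rewrite ?sh //.
  by apply: leq_trans (_ : zero_weight D <= k) => //; rewrite eD' perform_weight.
exists Dp; split; last by apply: rt_trans steps; apply: rt_step.
by split; rewrite ?sh' // v' eD' (perform_v idl gm pf).
Qed.

Theorem mainTheorem6 (n : nat) :
  complete_set_of_gamma_moves
    (fun (x y : box n) (S : pattern n) =>
       rectangular_move x y S \/ diagonal_move x y S).
Proof.
split=> [x y S|O idl D shD]; first exact: rect_or_diag_gamma_move.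
rewrite -shD in idl; have [Dp [gf steps]] := gamma_reachable idl.
exists Dp; split=> //; split=> // D' [sh' g' v'].
have [sh g vD] := gf.
by apply: gamma_uniq; rewrite ?sh ?sh' ?vD ?v'.
Qed.
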